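(* Let $(R,\mathfrak{m})$ be a commutative noetherian local ring and let $M=\coprod_{i\in I}M_i$ be a direct sum of $R$-modules in which every $M_i$ is coatomic. Then $\operatorname{Ass}(\hat M)=\operatorname{Koatt}(M)$.
   Context: An $R$-module is coatomic if every proper submodule is contained in a maximal submodule (over a noetherian local ring this is equivalent to: $\mathfrak{m}^eM$ is finitely generated for some $e\ge1$; in particular every finitely generated module is coatomic). $\hat M=\varprojlim M/\mathfrak{m}^nM$ is the $\mathfrak{m}$-adic completion, and $\operatorname{Ass}(\hat M)$ is the set of primes of $R$ associated to the $R$-module $\hat M$. $\operatorname{Koatt}(M)$ is the set of primes $\mathfrak{p}$ of $R$ such that $\mathfrak{p}=\operatorname{Ann}_R(U)$ for some submodule $U\subset M$. The index set $I$ is arbitrary. *)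

(* Defs.v *)
From HB Require Import structures.
From mathcomp Require Import all_boot all_order all_algebra.
From mathcomp Require Import boolp classical_sets functions cardinality.

Set Implicit Arguments.
Unset Strict Implicit.
Unset Printing Implicit Defensive.

Import GRing.Theory.

Local Open Scope ring_scope.
Local Open Scope quotient_scope.

(* Subsets are boolean predicates {pred T}; by classical logic (`[< _ >]) every
   subset arises this way.  A submodule is a predicate satisfying the library's
   submod_closed, and an ideal of R, possibly improper, is a submodule of R^o. *)

Section Submodules.
Variables (R : comNzRingType) (V : lmodType R).
Implicit Types N K U : {pred V}.

Definition proper_submodule N := submod_closed N /\ exists x, x \notin N.

Definition maximal_submodule N :=
  proper_submodule N /\
  forall K, proper_submodule K -> {subset N <= K} -> K =i N.

Definition coatomic :=
  forall U, proper_submodule U ->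
    exists N, maximal_submodule N /\ {subset U <= N}.

Definition finitely_generated N :=
  exists s : seq V, forall x,
    x \in N <-> exists c : 'I_(size s) -> R, x = \sum_i c i *: s`_i.

Definition annihilator U : {pred R} :=
  fun r => `[< forall x, x \in U -> r *: x = 0 >].

(* idealr_closed includes 1 \notin p. *)
Definition prime_ideal (p : {pred R}) :=
  idealr_closed p /\ prime_idealr_closed p.

Definition Ass : set {pred R} :=
  [set p | prime_ideal p /\ exists x : V, p =i [pred r | r *: x == 0]].

Definition Koatt : set {pred R} :=
  [set p | prime_ideal p /\
     exists U : {pred V}, submod_closed U /\ p =i annihilator U].

(* a N: the finite sums of products of elements of a and N. *)
Definition smul (a : {pred R}) N : {pred V} :=
  fun x => `[< exists s : seq (R * V),
    all (fun q => (q.1 \in a) && (q.2 \in N)) s /\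
    x = \sum_(q <- s) q.1 *: q.2 >].

Lemma smul_submod a N : submod_closed N -> submod_closed (smul a N).
Proof.
move=> [N0 Nlin]; split; first by apply/asboolP; exists [::]; rewrite big_nil.
move=> c u v /asboolP[s [sP ->]] /asboolP[t [tP ->]]; apply/asboolP.
exists ([seq (q.1, c *: q.2) | q <- s] ++ t); split.
  rewrite all_cat tP andbT all_map; apply: sub_all sP => q /= /andP[-> qN] /=.
  by rewrite -[_ *: _]addr0 Nlin.
rewrite big_cat big_map scaler_sumr; congr (_ + _).
by apply: eq_bigr => q _; rewrite !scalerA mulrC.
Qed.

End Submodules.

Arguments coatomic {R} V.
Arguments Ass {R} V.
Arguments Koatt {R} V.

Definition noetherian_ring (R : comNzRingType) :=
  forall a : {pred R^o}, submod_closed a -> finitely_generated a.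

Definition maximal_ideal (R : comNzRingType) (m : {pred R}) :=
  maximal_submodule (m : {pred R^o}).

(* m is the unique maximal ideal of R. *)
Definition local_ring (R : comNzRingType) (m : {pred R}) :=
  maximal_ideal m /\ forall m' : {pred R}, maximal_ideal m' -> m' =i m.

Definition dprod (R : comNzRingType) (I : Type) (M : I -> lmodType R) : Type :=
  forall i, M i.

Section Product.
Variables (R : comNzRingType) (I : Type) (M : I -> lmodType R).
Local Notation P := (dprod M).
Implicit Types f g h : P.

HB.instance Definition _ := gen_eqMixin P.
HB.instance Definition _ := gen_choiceMixin P.

Definition dprod_zero : P := fun i => 0.
Definition dprod_opp f : P := fun i => - f i.
Definition dprod_add f g : P := fun i => f i + g i.
Definition dprod_scale (r : R) f : P := fun i => r *: f i.

Fact dprod_addA : associative dprod_add.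
Proof. by move=> f g h; apply: functional_extensionality_dep => i; apply: addrA. Qed.
Fact dprod_addC : commutative dprod_add.
Proof. by move=> f g; apply: functional_extensionality_dep => i; apply: addrC. Qed.
Fact dprod_add0 : left_id dprod_zero dprod_add.
Proof. by move=> f; apply: functional_extensionality_dep => i; apply: add0r. Qed.
Fact dprod_addN : left_inverse dprod_zero dprod_opp dprod_add.
Proof. by move=> f; apply: functional_extensionality_dep => i; apply: addNr. Qed.

HB.instance Definition _ :=
  GRing.isZmodule.Build P dprod_addA dprod_addC dprod_add0 dprod_addN.

Fact dprod_scaleA a b f : dprod_scale a (dprod_scale b f) = dprod_scale (a * b) f.
Proof. by apply: functional_extensionality_dep => i; apply: scalerA. Qed.
Fact dprod_scale1 : left_id 1 dprod_scale.
Proof. by move=> f; apply: functional_extensionality_dep => i; apply: scale1r. Qed.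
Fact dprod_scaleDr : right_distributive dprod_scale +%R.
Proof. by move=> a f g; apply: functional_extensionality_dep => i; apply: scalerDr. Qed.
Fact dprod_scaleDl f : {morph dprod_scale^~ f : a b / a + b}.
Proof. by move=> a b; apply: functional_extensionality_dep => i; apply: scalerDl. Qed.

HB.instance Definition _ := GRing.Zmodule_isLmodule.Build R P
  dprod_scaleA dprod_scale1 dprod_scaleDr dprod_scaleDl.

Definition finite_support : {pred P} :=
  fun f => `[< finite_set [set i | f i != 0] >].

Fact finite_support_submod : submod_closed finite_support.
Proof.
split=> [|a f g /asboolP fP /asboolP gP]; apply/asboolP.
  by apply: (sub_finite_set (B := set0)) => [i /=|]; rewrite ?eqxx.
apply: (sub_finite_set (B := [set i | f i != 0] `|` [set i | g i != 0])).
  move=> i /=; have [fi0|] := eqVneq (f i) 0; last by left.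
  by move=> afg; right; apply: contraNN afg => /eqP gi0;
     apply/eqP; change (a *: f i + g i = 0); rewrite fi0 gi0 scaler0 addr0.
by rewrite finite_setU.
Qed.

HB.instance Definition _ :=
  GRing.isSubmodClosed.Build R P finite_support finite_support_submod.

Record dsum := DSum { dsum_val :> P ; dsum_valP : dsum_val \in finite_support }.

HB.instance Definition _ := [isSub for dsum_val].
HB.instance Definition _ := [Choice of dsum by <:].
HB.instance Definition _ := [SubChoice_isSubLmodule of dsum by <:].

End Product.

Section QuotientModule.
Variables (R : comNzRingType) (V : lmodType R) (N : submodClosed V).

(* submodClosed does not bundle closure under opposite, which the library's
   quotient needs. *)
Definition submod_pred : {pred V} := N.

Fact submod_pred_closed : zmod_closed submod_pred.
Proof. exact: submodClosedP. Qed.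

HB.instance Definition _ :=
  GRing.isZmodClosed.Build V submod_pred submod_pred_closed.

Definition quotmod := Quotient.quot submod_pred.

HB.instance Definition _ := GRing.Zmodule.on quotmod.
HB.instance Definition _ := ZmodQuotient.on quotmod.

Definition quotmod_scale (a : R) (x : quotmod) : quotmod :=
  \pi_quotmod (a *: repr x).

Lemma pi_quotmod_eq (x y : V) : (\pi_quotmod x == \pi_quotmod y) = (x - y \in N).
Proof. by rewrite -Quotient.idealrBE. Qed.

Lemma pi_quotmod_scale a (x : V) :
  quotmod_scale a (\pi_quotmod x) = \pi_quotmod (a *: x).
Proof.
apply/eqP; rewrite pi_quotmod_eq -scalerBr rpredZ// -pi_quotmod_eq.
by rewrite reprK.
Qed.

Lemma pi_quotmodD (x y : V) :
  \pi_quotmod (x + y) = \pi_quotmod x + \pi_quotmod y.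
Proof. by rewrite !piE. Qed.

Fact quotmod_scaleA a b x :
  quotmod_scale a (quotmod_scale b x) = quotmod_scale (a * b) x.
Proof.
rewrite -[x]reprK (pi_quotmod_scale b) (pi_quotmod_scale a).
by rewrite (pi_quotmod_scale (a * b)) scalerA.
Qed.
Fact quotmod_scale1 : left_id 1 quotmod_scale.
Proof. by move=> x; rewrite -[x]reprK !pi_quotmod_scale scale1r. Qed.
Fact quotmod_scaleDr : right_distributive quotmod_scale +%R.
Proof.
move=> a x y; rewrite -[x]reprK -[y]reprK -pi_quotmodD.
by rewrite !pi_quotmod_scale scalerDr pi_quotmodD.
Qed.
Fact quotmod_scaleDl x : {morph quotmod_scale^~ x : a b / a + b}.
Proof.
move=> a b; rewrite -[x]reprK !pi_quotmod_scale scalerDl.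
by rewrite pi_quotmodD.
Qed.

HB.instance Definition _ := GRing.Zmodule_isLmodule.Build R quotmod
  quotmod_scaleA quotmod_scale1 quotmod_scaleDr quotmod_scaleDl.

End QuotientModule.

Section Completion.
Variables (R : comNzRingType) (m : {pred R}) (V : lmodType R).

Fixpoint idealX (n : nat) : {pred R^o} :=
  if n is n'.+1 then smul m (idealX n') else predT.

Lemma idealX_submod n : submod_closed (idealX n).
Proof. by elim: n => [|n IH]; [split | apply: smul_submod]. Qed.

Lemma idealX_sub n : {subset idealX n.+1 <= idealX n}.
Proof.
move=> x /asboolP[s [/allP sP ->]].
have [I0 Ilin] := idealX_submod n.
rewrite big_seq; apply: (big_ind (fun y => y \in idealX n)) => // [y z yI zI|q].
  by rewrite -[y]scale1r Ilin.
by move=> /sP/andP[_ qI]; rewrite -[_ *: _]addr0 Ilin.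
Qed.

Definition mpow (n : nat) : {pred V} := smul (idealX n) predT.

Fact mpow_submod n : submod_closed (mpow n).
Proof. by apply: smul_submod; split. Qed.

HB.instance Definition _ n :=
  GRing.isSubmodClosed.Build R V (mpow n) (mpow_submod n).

Lemma mpow_sub n : {subset mpow n.+1 <= mpow n}.
Proof.
move=> x /asboolP[s [sP ->]]; apply/asboolP; exists s; split=> //.
by apply: sub_all sP => q /andP[/idealX_sub-> ->].
Qed.

Definition quot_mpow (n : nat) : lmodType R := quotmod (mpow n).

(* The map induced by the identity of V; see transitionE. *)
Definition transition (n : nat) (x : quot_mpow n.+1) : quot_mpow n :=
  \pi_(quotmod (mpow n)) (repr (x : quotmod (mpow n.+1))).

Lemma transitionE n (x : V) :
  transition (\pi_(quotmod (mpow n.+1)) x) = \pi_(quotmod (mpow n)) x.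
Proof.
apply/eqP; rewrite pi_quotmod_eq; apply: mpow_sub.
by rewrite -pi_quotmod_eq reprK.
Qed.

Lemma transition_linear n : linear (@transition n).
Proof.
move=> a x y.
rewrite -[x](@reprK _ (quotmod (mpow n.+1))) -[y](@reprK _ (quotmod (mpow n.+1))).
rewrite [a *: _](@pi_quotmod_scale _ _ (mpow n.+1)).
rewrite -[_ + _](@pi_quotmodD _ _ (mpow n.+1)) !transitionE pi_quotmodD.
by rewrite -(@pi_quotmod_scale _ _ (mpow n)).
Qed.

HB.instance Definition _ n := GRing.isLinear.Build R
  (quot_mpow n.+1) (quot_mpow n) *:%R (@transition n) (@transition_linear n).

Definition compatible : {pred dprod quot_mpow} :=
  fun x => `[< forall n, transition (x n.+1) = x n >].

Fact compatible_submod : submod_closed compatible.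
Proof.
split=> [|a x y /asboolP xP /asboolP yP]; apply/asboolP => n.
  exact: (raddf0 (@transition n)).
by rewrite -[RHS]/(a *: x n + y n) -xP -yP -linearP.
Qed.

HB.instance Definition _ :=
  GRing.isSubmodClosed.Build R (dprod quot_mpow) compatible compatible_submod.

(* The inverse limit of the modules V / m^n V. *)
Record completion := Completion
  { completion_val :> dprod quot_mpow ; completionP : completion_val \in compatible }.

HB.instance Definition _ := [isSub for completion_val].
HB.instance Definition _ := [Choice of completion by <:].
HB.instance Definition _ := [SubChoice_isSubLmodule of completion by <:].

End Completion.

(* Main.v *)
From HB Require Import structures.
Require Import Defs.
From mathcomp Require Import all_boot all_order all_algebra.
From mathcomp Require Import boolp classical_sets cardinality.

(** Write M for the direct sum and p for a prime.  The proof rests on one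
finiteness principle.  Call a submodule W critical for z when it is maximal
among the submodules that avoid z; by Zorn's lemma every submodule avoiding z
extends to such a W.  Then V / W has a simple socle, generated by z, and each of
its elements is killed by a power of m (critical_torsion).  Such a module is
artinian (critical_dcc): peeling off one generator of m at a time, this is the
dual of Hilbert's basis theorem.

If V is coatomic, a critical W contains m^K V for some K: by the descending
chain condition, V / W is the sum of the submodule killed by some m^K and of a
submodule that lies in every maximal submodule.  Hence every submodule of a
coatomic module is closed in the m-adic topology (coatomic_closed), and the rest
of the proof uses the M_i through this property.  It forbids sequences w_n in
m^n V all of whose linear relations have coefficients in m: the submodule
generated by the differences w_n - w_0 would contain w_0 in its closure but not
in itself (not_residually_free).  From this follow an
Artin-Rees lemma for arbitrary submodules (artin_rees), and the fact that a
prime other than m which annihilates a submodule exactly is already the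
annihilator of an element (koatt_annihilator_element).

Ass(completion) is contained in Koatt: let p be the annihilator of x in the
completion, approximated by elements y_n of M.  By artin_rees each coordinate of
y_n is, up to an arbitrarily high power of m, an element killed by p
(approximate_killed).  So whatever kills the submodule of M killed by p also
kills x, and that submodule has annihilator p.

Koatt is contained in Ass(completion): let p be the annihilator of a submodule
U, and suppose that no element of U has annihilator p.  Then p is also the
annihilator of the elements of U that vanish on a given finite set of
coordinates (tail_annihilator).  Call an ideal c recurrent if there are elements
killed by p, arbitrarily deep in the m-adic filtration and vanishing on any
prescribed finite set of coordinates, whose annihilator is contained in c.
 - Every a outside p is avoided by some recurrent ideal (recurrent_avoid).  Take
   u_n in U with disjoint supports, tending to 0, with a u_n nonzero, and W
   critical for a u_0 containing all a u_n - a u_0.  The descending chain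
   condition modulo W expresses a fixed u_k modulo W through arbitrarily late
   u_n, so the ideal of the r with r u_k in W is recurrent.
 - For each N some recurrent c_N is contained in c + m^N for every recurrent c
   (recurrent_minimal).  By Krull's intersection theorem (ideal_closed) the
   intersection of the c_N lies in every recurrent ideal, hence in p.
   Thus countably many ideals suffice, although R may be uncountable and not
   complete.
Choosing u_N with annihilator inside c_N, in m^N M and with disjoint supports,
the series of the u_N converges to an element of the completion whose
annihilator is p. *)

Set Implicit Arguments.
Unset Strict Implicit.
Unset Printing Implicit Defensive.

Import GRing.Theory.

Local Open Scope ring_scope.

(** * Submodules as predicates *)

Section Submodules.
Variables (R : comNzRingType) (V : lmodType R).
Implicit Types (N W B : {pred V}) (x y z : V).

Lemma scalerCA a b x : a *: (b *: x) = b *: (a *: x).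
Proof. by rewrite !scalerA mulrC. Qed.

Lemma smodZ N a x : submod_closed N -> x \in N -> a *: x \in N.
Proof. by move=> [N0 NL] xN; rewrite -[_ *: _]addr0 NL. Qed.

Lemma smodD N x y : submod_closed N -> x \in N -> y \in N -> x + y \in N.
Proof. by move=> [N0 NL] xN yN; rewrite -[x]scale1r NL. Qed.

Lemma smodB N x y : submod_closed N -> x \in N -> y \in N -> x - y \in N.
Proof. by move=> hN xN yN; rewrite smodD// -scaleN1r smodZ. Qed.

Lemma smodBC N x y : submod_closed N -> x - y \in N -> y - x \in N.
Proof. by move=> hN xy; rewrite -opprB -scaleN1r smodZ. Qed.

Lemma smod_transfer N x y : submod_closed N -> x - y \in N -> y \in N -> x \in N.
Proof. by move=> hN xy yN; rewrite -[x](subrK y) smodD. Qed.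

Lemma smod_sum N (I : Type) (s : seq I) (P : pred I) (F : I -> V) :
  submod_closed N -> (forall i, P i -> F i \in N) ->
  \sum_(i <- s | P i) F i \in N.
Proof.
by move=> hN FN; elim/big_rec: _ => [|i x Pi xN]; [case: hN | rewrite smodD ?FN].
Qed.

Definition line y : {pred V} := fun x => `[< exists r, x = r *: y >].

Lemma line_submod y : submod_closed (line y).
Proof.
split=> [|a _ _ /asboolP[r ->] /asboolP[s ->]]; apply/asboolP.
  by exists 0; rewrite scale0r.
by exists (a * r + s); rewrite scalerDl scalerA.
Qed.

Lemma line_gen y : y \in line y.
Proof. by apply/asboolP; exists 1; rewrite scale1r. Qed.

Definition sumsm N B : {pred V} := fun x => `[< exists2 b, b \in B & x - b \in N >].

Lemma sumsm_submod N B :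
  submod_closed N -> submod_closed B -> submod_closed (sumsm N B).
Proof.
move=> hN hB; split=> [|a x y /asboolP[b bB xN] /asboolP[c cB yN]].
  by apply/asboolP; exists 0; rewrite ?subr0; [case: hB | case: hN].
apply/asboolP; exists (a *: b + c); first by rewrite smodD// smodZ.
by rewrite opprD addrACA -scalerBr smodD// smodZ.
Qed.

Lemma sumsml N B x : submod_closed B -> x \in N -> x \in sumsm N B.
Proof. by move=> [B0 _] xN; apply/asboolP; exists 0 => //; rewrite subr0. Qed.

Lemma sumsmr N B x : submod_closed N -> x \in B -> x \in sumsm N B.
Proof. by move=> [N0 _] xN; apply/asboolP; exists x => //; rewrite subrr. Qed.

Lemma sumsmS N B B' : {subset B <= B'} -> {subset sumsm N B <= sumsm N B'}.
Proof. by move=> BB' x /asboolP[b /BB' bB xb]; apply/asboolP; exists b. Qed.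

Definition multiples a N : {pred V} := fun x => `[< exists2 y, y \in N & x = a *: y >].

Lemma multiples_submod a N : submod_closed N -> submod_closed (multiples a N).
Proof.
move=> hN; split=> [|b _ _ /asboolP[x xN ->] /asboolP[y yN ->]]; apply/asboolP.
  by exists 0; rewrite ?scaler0//; case: hN.
by exists (b *: x + y); rewrite ?smodD ?smodZ// scalerDr scalerCA.
Qed.

(** The descending chain condition for submodules of B / N. *)
Definition dcc_on N B := forall F : nat -> {pred V},
  (forall n, submod_closed (F n)) -> (forall n, {subset N <= F n}) ->
  (forall n, {subset F n <= B}) -> (forall n, {subset F n.+1 <= F n}) ->
  exists n, forall k, (n <= k)%N -> {subset F n <= F k}.

(** For W = 0 this is the submodule killed by S, usually written V[S]. *)
Definition colon (S : {pred R}) W : {pred V} :=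
  fun y => `[< forall a, a \in S -> a *: y \in W >].

Lemma colon_submod S W : submod_closed W -> submod_closed (colon S W).
Proof.
move=> hW; split=> [|a x y /asboolP xP /asboolP yP]; apply/asboolP => b bS.
  by rewrite scaler0; case: hW.
rewrite scalerDr scalerA mulrC -scalerA; apply: smodD (yP _ bS) => //.
exact: smodZ (xP _ bS).
Qed.

Definition meet N B : {pred V} := fun x => (x \in N) && (x \in B).

Lemma meet_submod N B : submod_closed N -> submod_closed B ->
  submod_closed (meet N B).
Proof.
move=> hN hB; split=> [|a x y /andP[xN xB] /andP[yN yB]]; apply/andP.
  by split; [case: hN | case: hB].
by split; rewrite smodD ?smodZ.
Qed.

(** Only initial segments of the sequence are summed over, so that combinations
of the same sequence can be added after padding with zero coefficients. *)
Definition comb (v : nat -> V) : {pred V} :=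
  fun x => `[< exists n (c : nat -> R), x = \sum_(i < n) c i *: v i >].

Lemma comb_widen (v : nat -> V) n k (c : nat -> R) : (n <= k)%N ->
  \sum_(i < n) c i *: v i = \sum_(i < k) (if (i < n)%N then c i else 0) *: v i.
Proof.
move=> nk; rewrite (big_ord_widen _ (fun i => c i *: v i) nk) big_mkcond.
by apply: eq_bigr => i _; case: ifP => // _; rewrite scale0r.
Qed.

Lemma comb_submod v : submod_closed (comb v).
Proof.
split=> [|a x y /asboolP[n [c ->]] /asboolP[k [d ->]]]; apply/asboolP.
  by exists 0%N, (fun=> 0); rewrite big_ord0.
rewrite (comb_widen v c (leq_maxl n k)) (comb_widen v d (leq_maxr n k)).
exists (maxn n k), (fun i => a * (if (i < n)%N then c i else 0) +
                       (if (i < k)%N then d i else 0)).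
rewrite scaler_sumr -big_split; apply: eq_bigr => i _ /=.
by rewrite scalerDl scalerA.
Qed.

Lemma comb_gen v n : v n \in comb v.
Proof.
apply/asboolP; exists n.+1, (fun i => (i == n)%:R).
rewrite big_ord_recr /= eqxx scale1r big1 ?add0r// => i _.
by rewrite ltn_eqF// scale0r.
Qed.

Lemma comb_sub v N : submod_closed N -> (forall n, v n \in N) ->
  {subset comb v <= N}.
Proof.
by move=> hN vN _ /asboolP[n [c ->]]; apply: smod_sum => // i _; apply: smodZ.
Qed.

Lemma zero_submod : submod_closed (pred1 (0 : V)).
Proof.
split=> [|a x y /eqP-> /eqP->]; first exact: eqxx.
by rewrite scaler0 addr0; exact: eqxx.
Qed.

(** Equivalently, the class of z is nonzero and lies in every nonzero submodule of
V / W. *)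
Definition critical W z := [/\ submod_closed W, z \notin W &
  forall B, submod_closed B -> {subset W <= B} -> z \notin B -> {subset B <= W}].

Lemma critical_exists N z : submod_closed N -> z \notin N ->
  exists2 W, critical W z & {subset N <= W}.
Proof.
move=> hN zN.
pose D (A : set V) : {pred V} := fun x => `[< A x \/ x \in N >].
pose P : set (set V) := fun A => submod_closed (D A) /\ z \notin D A.
(* D A joins N to A, so that the union of the empty chain is allowed too. *)
have [F FP Ftot|A [[hA zA] Amax]] := @Zorn_bigcup V P.
  have mem X x : F X -> X x -> exists2 Y, F Y & Y x by exists X.
  split; last first.
    apply/negP => /asboolP[[X FX Xz]|]; last by apply/negP.
    by have [_ /negP] := FP _ FX; apply; apply/asboolP; left.
  split; first by apply/asboolP; right; case: hN.
  move=> a x y /asboolP xF /asboolP yF.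
  have E (X : set V) u v : F X -> X u \/ u \in N -> X v \/ v \in N ->
      a *: u + v \in D (\bigcup_(X in F) X)%classic.
    move=> FX uX vX; have [[_ XL] _] := FP _ FX.
    have /asboolP[Xuv|Nuv] := XL a u v (introT (asboolP _) uX) (introT (asboolP _) vX).
      by apply/asboolP; left; exists X.
    by apply/asboolP; right.
  case: xF yF => [[X FX Xx]|xN] [[Y FY Yy]|yN].
  - by have [XY|YX] := Ftot _ _ FX FY; [apply: (E Y) | apply: (E X)] => //; left;
      rewrite ?(XY x)// ?(YX y); auto.
  - by apply: (E X) => //; [left|right].
  - by apply: (E Y) => //; [right|left].
  - by apply/asboolP; right; rewrite smodD ?smodZ.
exists (D A); last by move=> x xN; apply/asboolP; right.
split=> // B hB AB zB x xB.
apply: contrapT => xA; apply: (Amax [set y | y \in B]%classic).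
  split; first by move=> y Ay /=; apply: AB; apply/asboolP; left.
  by move=> BA; apply: xA; apply/asboolP; left; apply: BA.
have e : D [set y | y \in B]%classic =i B.
  move=> y; apply/asboolP/idP => [[//|yN]|yB]; last by left.
  by apply: AB; apply/asboolP; right.
split; last by rewrite e.
by split; rewrite ?e; [case: hB | move=> a u v; rewrite !e => uB vB; rewrite smodD ?smodZ].
Qed.

End Submodules.

Lemma critical_line (R : comNzRingType) (V : lmodType R) (W : {pred V}) (z y : V) :
  critical W z -> y \notin W -> exists r, z - r *: y \in W.
Proof.
move=> [hW zW Wmax] yW; have hL := line_submod y.
have : z \in sumsm W (line y).
  apply: contraNT yW => zB; apply: (Wmax _ _ _ zB); first exact: sumsm_submod.
    by move=> x; apply: sumsml.
  by apply: sumsmr => //; apply: line_gen.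
by move=> /asboolP[_ /asboolP[r ->] zr]; exists r.
Qed.

(** * Powers of an ideal *)

Section MaximalPowers.
Variables (R : comNzRingType) (m : {pred R}).

Lemma mpow_scale (V : lmodType R) n (r : R) (y : V) :
  r \in idealX m n -> r *: y \in mpow m n.
Proof.
move=> rI; apply/asboolP; exists [:: (r, y)].
by rewrite /= rI; split=> //; rewrite big_seq1.
Qed.

Lemma mpow_min (V : lmodType R) n (N : {pred V}) : submod_closed N ->
  (forall (r : R) y, r \in idealX m n -> r *: y \in N) -> {subset mpow m n <= N}.
Proof.
move=> hN rN _ /asboolP[s [/allP sP ->]]; rewrite big_seq.
by apply: smod_sum => // q /sP /andP[qI _]; apply: rN.
Qed.

Lemma mpow0 (V : lmodType R) (y : V) : y \in mpow m 0.
Proof. by rewrite -[y]scale1r mpow_scale. Qed.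

Lemma mpow_mono (V : lmodType R) n k (y : V) :
  (n <= k)%N -> y \in mpow m k -> y \in mpow m n.
Proof.
by move=> /subnK <-; elim: (k - n)%N => [//|d IH]; rewrite addSn => /mpow_sub /IH.
Qed.

Lemma idealX_mono n k r : (n <= k)%N -> r \in idealX m k -> r \in idealX m n.
Proof.
by move=> /subnK <-; elim: (k - n)%N => [//|d IH]; rewrite addSn => /idealX_sub /IH.
Qed.

Lemma idealXS_mul n (a b : R) : a \in m -> b \in idealX m n -> a * b \in idealX m n.+1.
Proof.
move=> am bI; apply/asboolP; exists [:: (a, b)]; rewrite /= am bI; split=> //.
by rewrite big_seq1.
Qed.

Lemma idealXS_min n (N : {pred R^o}) : submod_closed N ->
  (forall a b : R, a \in m -> b \in idealX m n -> a * b \in N) ->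
  {subset idealX m n.+1 <= N}.
Proof.
move=> hN abN _ /asboolP[s [/allP sP ->]]; rewrite big_seq.
by apply: smod_sum => // q /sP /andP[qm qI]; apply: abN.
Qed.

Lemma idealX_exp n t : t \in m -> t ^+ n \in idealX m n.
Proof. by move=> tm; elim: n => [//|n IH]; rewrite exprS idealXS_mul. Qed.

Lemma mpow_linear (V V' : lmodType R) (f : {linear V -> V'}) n y :
  y \in mpow m n -> f y \in mpow m n.
Proof.
move=> /asboolP[s [/allP sP ->]]; rewrite linear_sum big_seq.
apply: smod_sum => [|q /sP /andP[qI _]]; first exact: mpow_submod.
by rewrite linearZ mpow_scale.
Qed.

End MaximalPowers.

(** * The descending chain condition modulo a critical submodule *)

Section LocalRing.
Variables (R : comNzRingType) (m : {pred R}).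
Hypotheses (noethR : noetherian_ring R) (localR : local_ring m).

Lemma m_submod : submod_closed (m : {pred R^o}).
Proof. by have [[[]]] := localR. Qed.

Lemma one_notin_m : 1 \notin m.
Proof.
have [[[hm [x xm]] _] _] := localR.
by apply: contraNN xm => m1; rewrite -[x]mulr1; apply: smodZ hm m1.
Qed.

(** An ideal critical for 1 is a maximal ideal, hence equal to m. *)
Lemma proper_sub_m (a : {pred R^o}) :
  submod_closed a -> 1 \notin a -> {subset a <= m}.
Proof.
move=> ha a1; have [N [hN N1 Nmax] aN] := critical_exists ha a1.
suff Nm : N =i m by move=> x /aN; rewrite Nm.
apply: (proj2 localR); split; first by split=> //; exists 1.
move=> K [hK [x xK]] NK y; apply/idP/idP => [|/NK //]; apply: Nmax => //.
by apply: contraNN xK => K1; rewrite -[x]mulr1; apply: smodZ hK K1.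
Qed.

Lemma unit_notin_m r : r \notin m -> exists s, s * r = 1.
Proof.
move=> rm; have hL := line_submod (r : R^o).
have [/asboolP[s]|L1] := boolP (1 \in line (r : R^o)); first by exists s.
by case/negP: rm; apply: (proper_sub_m hL L1); apply: line_gen.
Qed.

(** Elements outside m are units. *)
Lemma scale_notin_m (V : lmodType R) (W : {pred V}) r y :
  submod_closed W -> r \notin m -> r *: y \in W -> y \in W.
Proof.
move=> hW /unit_notin_m[s sr] ryW.
by rewrite -[y]scale1r -sr -scalerA smodZ.
Qed.

(** The generators are presented through what they are used for: to carry y into
a submodule, it suffices that they do. *)
Lemma ideal_generators (a : {pred R^o}) : submod_closed a ->
  exists s : seq R, {subset s <= a} /\
    forall (V : lmodType R) (W : {pred V}) (y : V), submod_closed W ->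
      (forall x, x \in s -> x *: y \in W) -> forall x, x \in a -> x *: y \in W.
Proof.
move=> /noethR[s sP]; exists s; split=> [x /(nthP 0)[i lti <-]|V W y hW sW x].
  apply/sP; exists (fun j => (j == i :> nat)%:R).
  rewrite (bigD1 (Ordinal lti))//= eqxx scale1r big1 ?addr0// => j ji.
  by rewrite -val_eqE/= in ji; rewrite (negPf ji) scale0r.
move=> /sP[c ->]; rewrite scaler_suml; apply: smod_sum => // i _.
by rewrite -scalerA smodZ// sW// mem_nth.
Qed.

(** The union of a strictly increasing sequence of ideals would be finitely
generated, hence equal to a member of the sequence. *)
Lemma ideal_maximal (P : {pred R^o} -> Prop) a0 :
  (forall a, P a -> submod_closed a) -> P a0 ->
  exists2 a, P a & forall b, P b -> {subset a <= b} -> {subset b <= a}.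
Proof.
move=> PI Pa0; apply: contrapT => nmax.
have next (a : sig P) : {b : sig P |
    {subset sval a <= sval b} /\ ~ {subset sval b <= sval a}}.
  apply: cid; apply: contrapT => nb; apply: nmax; exists (sval a); first exact: svalP.
  move=> b Pb ab; apply: contrapT => ba; apply: nb.
  by exists (exist _ b Pb).
have [f [_ fS]] := dependent_choice next (exist _ a0 Pa0).
have fmono n k : (n <= k)%N -> {subset sval (f n) <= sval (f k)}.
  by move=> /subnK <-; elim: (k - n)%N => [//|d IH] x /IH /(proj1 (fS _)).
have hf n := PI _ (svalP (f n)).
pose u : {pred R^o} := fun x => `[< exists n, x \in sval (f n) >].
have hu : submod_closed u.
  split=> [|r x y /asboolP[n xn] /asboolP[k yk]]; apply/asboolP.
    by exists 0%N; case: (hf 0%N).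
  exists (maxn n k); rewrite smodD// ?smodZ//.
    exact: fmono (leq_maxl n k) _ xn.
  exact: fmono (leq_maxr n k) _ yk.
have [s [su sgen]] := ideal_generators hu.
have [n sn] : exists n, {subset s <= sval (f n)}.
  elim: s su {sgen} => [|x s IH] su; first by exists 0%N.
  have [|n sn] := IH; first by move=> y ys; apply: su; rewrite inE ys orbT.
  have /asboolP[k xk] := su x (mem_head _ _); exists (maxn n k) => y.
  rewrite inE => /predU1P[->|/sn].
    exact: fmono (leq_maxr n k) _ xk.
  exact: fmono (leq_maxl n k) _.
have [_] := fS n; apply=> x xf.
have := sgen _ (sval (f n)) (1 : R^o) (hf n) _ x; rewrite /= [_ *: _]mulr1; apply.
  by move=> y /sn; rewrite [_ *: _]mulr1.
by apply/asboolP; exists n.+1.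
Qed.

Section Critical.
Variables (V : lmodType R) (W : {pred V}) (z : V).
Hypothesis Wz : critical W z.

(** If x z were outside W then z would be congruent to r x z modulo W, and
1 - r x is a unit. *)
Lemma critical_socle x : x \in m -> x *: z \in W.
Proof.
move=> xm; have [hW zW _] := Wz; apply: contraNT zW => /(critical_line Wz)[r].
rewrite scalerA -[z in z - _]scale1r -scalerBl; apply: scale_notin_m => //.
apply: contraNN one_notin_m => rx; rewrite -[1](subrK (r * x)).
by apply: smodD m_submod rx _; apply: smodZ m_submod xm.
Qed.

(** Otherwise choose r such that the ideal (W : r y) is maximal among those that
contain no power of m.  Some generator x of m satisfies the same with x r y, so
that (W : x r y) = (W : r y).  Since x r y is not in W, z is congruent to some
b x r y modulo W; as x z is in W, the scalar b x lies in (W : x r y), hence in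
(W : r y), and z is in W. *)
Lemma critical_torsion y : exists K, forall r : R, r \in idealX m K -> r *: y \in W.
Proof.
have [hW zW _] := Wz.
pose col (v : V) : {pred R^o} := fun r : R => r *: v \in W.
have hcol v : submod_closed (col v).
  split=> [|a r s rW sW]; rewrite unfold_in; first by rewrite scale0r; case: hW.
  rewrite scalerDl -scalerA; exact: smodD hW (smodZ a hW rW) sW.
apply: contrapT => ny.
pose P (a : {pred R^o}) := exists2 r : R, a = col (r *: y) &
  ~ exists K, {subset idealX m K <= a}.
have PI a : P a -> submod_closed a by move=> [r -> _].
have Py : P (col y).
  by exists 1; rewrite ?scale1r// => -[K yK]; apply: ny; exists K => s /yK.
have [_ [r -> nK] rmax] := ideal_maximal PI Py.
have [s [sm sgen]] := ideal_generators m_submod.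
have [x xs nx] : exists2 x, x \in s & ~ exists K, {subset idealX m K <= col (x *: (r *: y))}.
  apply: contrapT => nx; apply: nK.
  have [K sK] : exists K, forall x, x \in s ->
      {subset idealX m K <= col (x *: (r *: y))}.
    elim: s {sm sgen} nx => [|x s IH] nx; first by exists 0%N.
    have [[u us nu]|K sK] := IH; first by apply: nx; exists u; rewrite ?inE ?us ?orbT.
    have [k xk] : exists k, {subset idealX m k <= col (x *: (r *: y))}.
      by apply: contrapT => xk; apply: nx; exists x; rewrite ?mem_head.
    exists (maxn K k) => u; rewrite inE => /predU1P[-> a|us a] aI.
      by apply: xk; apply: idealX_mono aI; apply: leq_maxr.
    by apply: (sK _ us); apply: idealX_mono aI; apply: leq_maxl.
  exists K.+1; apply: idealXS_min => // a b am bI; rewrite unfold_in -scalerA.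
  apply: sgen am => // x xs.
  by rewrite scalerCA; apply: sK bI.
have ryW a : a \in col (x *: (r *: y)) -> a *: (r *: y) \in W.
  apply: (rmax (col (x *: (r *: y)))); first by exists (x * r) => //; rewrite scalerA.
  by move=> b bW; rewrite unfold_in scalerCA; apply: smodZ.
have : x *: (r *: y) \notin W.
  apply/negP => xW; apply: nx; exists 0%N => a _; rewrite unfold_in.
  by apply: smodZ.
move=> /(critical_line Wz)[b zb]; case/negP: zW.
apply: (smod_transfer hW zb).
have bx : b * x \in col (x *: (r *: y)).
  rewrite unfold_in -scalerA scalerCA.
  apply: (smod_transfer hW) (critical_socle (sm _ xs)).
  by rewrite -scalerBr smodZ// smodBC.
by have := ryW _ bx; rewrite -scalerA.
Qed.

Lemma decreasing_subset (F : nat -> {pred V}) : (forall n, {subset F n.+1 <= F n}) ->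
  forall n k, (n <= k)%N -> {subset F k <= F n}.
Proof.
move=> FS n k /subnK <-; elim: (k - n)%N => [//|d IH] x.
by rewrite addSn => /FS /IH.
Qed.

(** Modulo W the elements killed by m form the line spanned by z. *)
Lemma dcc_socle (s : seq R) :
  (forall y, (forall x, x \in s -> x *: y \in W) -> forall x, x \in m -> x *: y \in W) ->
  dcc_on W (colon [in s] W).
Proof.
move=> sgen F hF WF Fs FS; have [hW zW _] := Wz.
have [[n Fn]|nF] := pselect (exists n, {subset F n <= W}).
  by exists n => k _ x /Fn /WF.
exists 0%N => k _ y yF.
have zF : z \in F k.
  apply: contrapT => zF; apply: nF; exists k => u uF; apply: contrapT => /negP uW.
  have [r zr] := critical_line Wz uW; apply: zF.
  by apply: (smod_transfer (hF k)) (WF _ _ zr) _; apply: smodZ.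
have [/WF //|yW] := boolP (y \in W).
have [r zr] := critical_line Wz yW.
have ym : forall x, x \in m -> x *: y \in W.
  by apply: sgen => x xs; have /asboolP := Fs _ _ yF; apply.
have rm : r \notin m.
  by apply: contraNN zW => /ym; apply: smod_transfer.
apply: (scale_notin_m (hF k) rm); rewrite -[_ *: _](subKr z).
by apply: smodB => //; apply: WF.
Qed.

(** The dual of Hilbert's basis theorem, for multiplication by x on the submodule
of V / W killed by s: its kernel is artinian and every element is killed by a
power of x, so a descending chain F is determined by the submodules C i j of the
kernel that consist of the classes of x^i b with b in F j. *)
Lemma dcc_colon_cons x (s : seq R) : x \in m ->
  dcc_on W (colon [in x :: s] W) -> dcc_on W (colon [in s] W).
Proof.
move=> xm dcc F hF WF Fs FS; have [hW zW _] := Wz.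
pose C i j := meet (colon [in x :: s] W) (sumsm W (multiples (x ^+ i) (F j))).
have hC i j : submod_closed (C i j).
  by apply: meet_submod; [apply: colon_submod | apply/sumsm_submod/multiples_submod].
have WC i j : {subset W <= C i j}.
  move=> y yW; apply/andP; split; first by apply/asboolP => a _; apply: smodZ.
  by apply: sumsml => //; apply: multiples_submod.
have CX i j : {subset C i j <= colon [in x :: s] W} by move=> y /andP[].
have Cj i j : {subset C i j.+1 <= C i j}.
  move=> y /andP[yX yF]; apply/andP; split=> //; apply: sumsmS yF.
  by move=> _ /asboolP[b /FS bF ->]; apply/asboolP; exists b.
have Ci i j : {subset C i.+1 j <= C i j}.
  move=> y /andP[yX yF]; apply/andP; split=> //; apply: sumsmS yF.
  move=> _ /asboolP[b bF ->]; apply/asboolP; exists (x *: b); first exact: smodZ.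
  by rewrite scalerA exprSr.
(* C decreases in both indices: a stable diagonal takes care of all i >= n0, and
   the finitely many remaining rows stabilize one by one. *)
have [n0 stab0] := dcc (fun n => C n n) (fun n => hC n n) (fun n => WC n n)
  (fun n => CX n n) (fun n y yC => Ci _ _ _ (Cj _ _ _ yC)).
have [j0 stab] : exists j0, forall i j, (i < n0)%N -> (j0 <= j)%N ->
    {subset C i j0 <= C i j}.
  elim: n0 {stab0} => [|n [j0 IH]]; first by exists 0%N.
  have [j1 st1] := dcc (C n) (hC n) (WC n) (CX n) (Cj n).
  exists (maxn j0 j1) => i j; rewrite ltnS leq_eqVlt geq_max.
  case/predU1P=> [-> /andP[_ jj]|i_n /andP[jj _]] y yC.
    apply: st1 jj _ _; apply: (decreasing_subset (Cj n)) yC; exact: leq_maxr.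
  by apply: IH i_n jj _ _; apply: (decreasing_subset (Cj i)) yC; apply: leq_maxl.
pose N := maxn n0 j0.
have stabN i j : (N <= j)%N -> {subset C i N <= C i j}.
  move=> Nj y; have [i_n|n_i] := ltnP i n0; move=> yC.
    apply: stab i_n (leq_trans (leq_maxr _ _) Nj) _ _.
    by apply: (decreasing_subset (Cj i)) yC; apply: leq_maxr.
  have yC0 : y \in C n0 n0.
    apply: (decreasing_subset (fun l => @Ci l n0) n_i).
    by apply: (decreasing_subset (Cj i)) yC; apply: leq_maxl.
  have := stab0 (maxn i j) (leq_trans n_i (leq_maxl _ _)) _ yC0.
  move=> /(decreasing_subset (fun l => @Ci l _) (leq_maxl i j)).
  exact: (decreasing_subset (Cj i) (leq_maxr i j)).
(* Induction on the power of x that carries b into W. *)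
exists N => j Nj b bF.
have [K xK] := critical_torsion b.
have := xK _ (idealX_exp K xm); elim: K b bF {xK} => [|n IH] b bF.
  by rewrite expr0 scale1r; apply: WF.
move=> xb; have : x ^+ n *: b \in C n N.
  apply/andP; split; last first.
    by apply: sumsmr => //; apply/asboolP; exists b.
  apply/asboolP => a; rewrite inE => /predU1P[->|sa]; first by rewrite scalerA -exprS.
  by rewrite scalerCA smodZ//; have /asboolP := Fs _ _ bF; apply.
move=> /(stabN _ _ Nj) /andP[_ /asboolP[_ /asboolP[c cF ->]]].
rewrite -scalerBr => /IH bc.
have cN : c \in F N := decreasing_subset FS Nj cF.
by apply: (smod_transfer (hF j)) cF; apply: bc; apply: smodB.
Qed.

Lemma critical_dcc : dcc_on W predT.
Proof.
have [s [sm sgen]] := ideal_generators m_submod; have [hW _ _] := Wz.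
have := dcc_socle (fun y => sgen V W y hW).
elim: s sm {sgen} => [|x s IH] sm dcc.
  move=> F hF WF _; apply: dcc => // n y _; exact/asboolP.
by apply: IH (dcc_colon_cons _ dcc) => [y ys|]; apply: sm; rewrite inE ?eqxx ?ys ?orbT.
Qed.

(** The chain condition as a minimum principle. *)
Lemma critical_minimal (P : {pred V} -> Prop) B0 :
  (forall B, P B -> submod_closed B /\ {subset W <= B}) -> P B0 ->
  exists2 B, P B & forall B', P B' -> {subset B' <= B} -> {subset B <= B'}.
Proof.
move=> PB PB0; apply: contrapT => nmin.
have next (B : sig P) : {B' : sig P |
    {subset sval B' <= sval B} /\ ~ {subset sval B <= sval B'}}.
  apply: cid; apply: contrapT => nb; apply: nmin; exists (sval B); first exact: svalP.
  move=> B' PB' B'B; apply: contrapT => BB'; apply: nb.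
  by exists (exist _ B' PB').
have [f [_ fS]] := dependent_choice next (exist _ B0 PB0).
have [n|n|n|n|n] := critical_dcc (F := fun n => sval (f n)).
- exact: (proj1 (PB _ (svalP (f n)))).
- exact: (proj2 (PB _ (svalP (f n)))).
- by [].
- exact: (proj1 (fS n)).
by move=> /(_ n.+1 (leqnSn n)); have [_] := fS n.
Qed.

End Critical.

(** * Coatomic modules *)

Lemma maximal_submodule_line (V : lmodType R) (N : {pred V}) b :
  maximal_submodule N -> b \notin N -> forall y, exists r, y - r *: b \in N.
Proof.
move=> [[hN _] Nmax] bN y; have hL := line_submod b; have hS := sumsm_submod hN hL.
have /asboolP[_ /asboolP[r ->] yr] : y \in sumsm N (line b); last by exists r.
apply: contrapT => /negP yS; move/negP: bN; apply.
rewrite -(Nmax (sumsm N (line b))); last by move=> x; apply: sumsml.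
  by apply: sumsmr => //; apply: line_gen.
by split=> //; exists y.
Qed.

(** All submodules are closed in the m-adic topology. *)
Definition closed_submodules (V : lmodType R) := forall (N : {pred V}) z,
  submod_closed N -> (forall n, z \in sumsm (mpow m n) N) -> z \in N.

(** Let W contain the given submodule and be critical for a point z outside it,
and let T K be the submodule killed by m^K modulo W.  Among the submodules B
with T K + B = V for some K, a minimal one lies in every maximal submodule that
contains W: otherwise its intersection with that maximal submodule would be
smaller, at the cost of a larger K.  Hence T K is in no maximal submodule, and
T K = V since V is coatomic.  So m^K V is in W, and z is not in the closure. *)
Lemma coatomic_closed (V : lmodType R) : coatomic V -> closed_submodules V.
Proof.
move=> coatV N z hN zN; apply: contrapT => /negP /(critical_exists hN)[W Wz NW].
have [hW zW _] := Wz.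
pose T K : {pred V} := colon (idealX m K) W.
have hT K : submod_closed (T K) by apply: colon_submod.
have T_mono K L : (K <= L)%N -> {subset T K <= T L}.
  move=> KL y /asboolP yK; apply/asboolP => a aL; apply: yK.
  exact: idealX_mono KL aL.
have WT K : {subset W <= T K} by move=> y yW; apply/asboolP => a _; apply: smodZ.
pose P (B : {pred V}) := [/\ submod_closed B, {subset W <= B} &
  exists K, forall y, y \in sumsm (T K) B].
have P0 : P predT.
  split=> //; exists 0%N => y; exact: sumsmr.
have [|B [hB WB [K KB]] Bmin] := critical_minimal Wz _ P0; first by move=> B [].
have all_T y : y \in T K.
  apply: contrapT => /negP yT.
  have [|N' [maxN' TN']] := coatV (T K); first by split=> //; exists y.
  have [[hN' [x xN']] _] := maxN'.
  have BN' : {subset B <= N'}.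
    move=> b bB; apply: contrapT => /negP bN'.
    suff /(_ _ bB)/andP[_ /negP] : {subset B <= meet B N'} by move/negP: bN'.
    apply: Bmin => [|u /andP[]//]; split; first exact: meet_submod.
      by move=> u uW; apply/andP; split; [apply: WB | apply/TN'/WT].
    have [L bL] := critical_torsion Wz b.
    (* V / N' is simple, so B is spanned by b and its intersection with N'. *)
    exists (maxn K L) => u; have /asboolP[c cB uc] := KB u.
    have [r cr] := maximal_submodule_line maxN' bN' c.
    apply/asboolP; exists (c - r *: b).
      by apply/andP; split=> //; apply: smodB => //; apply: smodZ.
    rewrite opprB addrCA addrC; apply: smodD => //.
      exact: T_mono (leq_maxl _ _) _ uc.
    apply: smodZ => //; apply: (T_mono L); first exact: leq_maxr.
    exact/asboolP.
  have /asboolP[c /BN' cN' xc] := KB x.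
  by case/negP: xN'; apply: (smod_transfer hN') cN'; apply: TN'.
have /asboolP[u /NW uW zu] := zN K.
case/negP: zW; apply: (smod_transfer hW) uW.
apply: (mpow_min hW) zu => r y rI.
by have /asboolP := all_T y; apply.
Qed.

(** The zero submodule is closed. *)
Lemma separated (V : lmodType R) (y : V) : closed_submodules V ->
  (forall n, y \in mpow m n) -> y = 0.
Proof.
move=> closedV yn; apply/eqP; apply: (closedV _ _ (zero_submod V)) => n.
apply: sumsml; [exact: zero_submod | exact: yn].
Qed.

(** When m carries the w i into C, this is linear independence of their classes
modulo C over the residue field. *)
Definition residually_free (V : lmodType R) (C : {pred V}) (w : nat -> V) :=
  forall n (c : nat -> R), \sum_(i < n) c i *: w i \in C ->
  forall i, (i < n)%N -> c i \in m.

Lemma residually_free_diff (V : lmodType R) (C : {pred V}) (w : nat -> V) :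
  submod_closed C -> residually_free C w ->
  w 0%N \notin sumsm C (comb (fun n => w n.+1 - w 0%N)).
Proof.
move=> hC wC; apply/asboolP => -[_ /asboolP[n [c ->]]] hw.
(* Coefficients of the relation obtained by moving everything to one side; they
   are all in m, and so is 1, the sum of all of them. *)
pose d i := if i is j.+1 then - c j else 1 + \sum_(j < n) c j.
have dC : \sum_(i < n.+1) d i *: w i \in C.
  rewrite big_ord_recl /= scalerDl scale1r scaler_suml.
  have -> : \sum_(i < n) - c i *: w i.+1 = - \sum_(i < n) c i *: w i.+1.
    by rewrite -sumrN; apply: eq_bigr => i _; rewrite scaleNr.
  rewrite -addrA -sumrB -[X in _ + X]opprK -sumrN /=.
  congr (_ \in C): hw; congr (_ - _); apply: eq_bigr => i _.
  by rewrite scalerBr opprB.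
have dm := wC _ _ dC.
have cm : \sum_(j < n) c j \in m.
  apply: (@smod_sum R R^o m _ _ predT (fun i : 'I_n => c i) m_submod) => i _.
  have := dm i.+1; rewrite ltnS ltn_ord => /(_ isT) /= /(smodZ (-1) m_submod).
  by rewrite [_ *: _]mulN1r opprK.
by have /negP := one_notin_m; apply; rewrite -[1](addrK (\sum_(j < n) c j));
  apply: (smodB m_submod) cm; apply: (dm 0%N).
Qed.

(** The submodule spanned by C and the differences contains w 0 in its closure,
since w n.+1 tends to 0. *)
Lemma not_residually_free (V : lmodType R) (C : {pred V}) (w : nat -> V) :
  closed_submodules V -> submod_closed C -> (forall n, w n \in mpow m n) ->
  ~ residually_free C w.
Proof.
move=> closedV hC wm wC; have hS := comb_submod (fun n => w n.+1 - w 0%N).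
have /negP := residually_free_diff hC wC; apply; apply: closedV => [|n].
  exact: sumsm_submod.
apply/asboolP; exists (w 0%N - w n.+1).
  apply: smodBC; first exact: sumsm_submod.
  apply: sumsmr => //; exact: (comb_gen (fun n => w n.+1 - w 0%N)).
rewrite subKr; apply: (mpow_mono (k := n.+1)) => //.
Qed.

(** Otherwise there are elements w of B outside C, in arbitrarily high m^K V,
with m w in C.  A residually free sequence of them is built inductively: D is
spanned by C and the elements already chosen, and D meets m^K V inside C for
some K, because the submodules between C and D are closed and D / C is a
finite-dimensional vector space.  The next element is taken in m^K V. *)
Lemma artin_rees (V : lmodType R) (C B : {pred V}) N : closed_submodules V ->
  submod_closed C -> submod_closed B ->
  (forall (r : R) y, r \in idealX m N -> y \in B -> r *: y \in C) ->
  exists K, forall y, y \in B -> y \in mpow m K -> y \in C.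
Proof.
move=> closedV hC hB BC; apply: contrapT => noK.
have socle K : exists w, [/\ w \in mpow m K, w \notin C & forall x, x \in m -> x *: w \in C].
  have [y [yB yK yC]] : exists y, [/\ y \in B, y \in mpow m K & y \notin C].
    apply: contrapT => ny; apply: noK; exists K => y yB yK.
    by apply: contrapT => /negP yC; apply: ny; exists y.
  have yN (r : R) : r \in idealX m N -> r *: y \in C by move=> rI; apply: BC.
  elim: N y yK yC yN {BC yB} => [|N IH] y yK yC yN.
    by case/negP: yC; rewrite -[y]scale1r yN.
  have [|/existsNP[x /not_implyP[xm /negP xy]]] := pselect (forall x, x \in m -> x *: y \in C).
    by move=> mC; exists y.
  apply: IH xy _ => [|r rI]; first by apply: smodZ yK; apply: mpow_submod.
  by rewrite scalerA mulrC yN// idealXS_mul.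
pose P (s : {pred V} * nat) := [/\ submod_closed s.1, {subset C <= s.1} &
  forall y, y \in s.1 -> y \in mpow m s.2 -> y \in C].
pose step (s s' : sig P) := exists w,
  [/\ w \in mpow m (sval s).2, w \notin (sval s).1, forall x, x \in m -> x *: w \in C,
      {subset (sval s).1 <= (sval s').1} /\ w \in (sval s').1 &
      ((sval s).2 < (sval s').2)%N].
have next s : {s' | step s s'}.
  apply: cid; case: s => -[D K] [/= hD CD DK].
  have [w [wK wC mw]] := socle K; have hL := line_submod w.
  have wD : w \notin D by apply: contraNN wC => wD; apply: DK.
  have [L wL] : exists L, w \notin sumsm (mpow m L) D.
    apply: contrapT => nL; case/negP: wD; apply: closedV => // n.
    by apply: contrapT => /negP wn; apply: nL; exists n.
  have D'P : P (sumsm D (line w), maxn L K.+1).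
    split=> /= [|y yC|y /asboolP[_ /asboolP[r ->] yr] yK]; first exact: sumsm_submod.
      by apply: sumsml => //; apply: CD.
    have hS : submod_closed (sumsm (mpow m L) D) by apply/sumsm_submod/hD/mpow_submod.
    have rm : r \in m.
      apply: contraNT wL => rm; apply: (scale_notin_m hS rm).
      rewrite -[r *: w](subKr y); apply: smodB => //.
        by apply: sumsml => //; apply: mpow_mono yK; apply: leq_maxl.
      by apply: sumsmr => //; apply: mpow_submod.
    apply: DK; first exact: (smod_transfer hD yr) (CD _ (mw _ rm)).
    by apply: mpow_mono yK; apply: leq_trans (leq_maxr _ _).
  exists (exist _ _ D'P), w; split=> //=; last exact: leq_maxr.
  by split=> [y yD|]; [apply: sumsml | apply/sumsmr/line_gen].
have P0 : P (C, 0%N) by split.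
have [f [_ fS]] := dependent_choice next (exist _ _ P0).
have [w wP] := choice fS.
have Kn n : (n <= (sval (f n)).2)%N.
  by elim: n => // n IH; have [_ _ _ _ lt] := wP n; apply: leq_ltn_trans lt.
have Df n k : (n < k)%N -> w n \in (sval (f k)).1.
  elim: k => // k IH; rewrite ltnS leq_eqVlt; have [_ _ _ [DD wD] _] := wP k.
  by case/predU1P=> [->//|/IH]; apply: DD.
apply: (not_residually_free (w := w) closedV hC) => [n|].
  by have [wm _ _ _ _] := wP n; apply: mpow_mono wm.
elim=> [//|n IH] c; rewrite big_ord_recr /= => sC.
have [_ wD mw _ _] := wP n; have [hD CD _] := svalP (f n).
have cm : c n \in m.
  apply: contraNT wD => cm; apply: (scale_notin_m hD cm).
  rewrite -[_ *: _](addKr (\sum_(i < n) c i *: w i)) addrC; apply: smodB => //.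
    exact: CD.
  by apply: smod_sum => // i _; apply: smodZ => //; apply: Df.
have {}sC : \sum_(i < n) c i *: w i \in C.
  by rewrite -[X in X \in _](addrK (c n *: w n)) smodB ?mw.
by move=> i; rewrite ltnS leq_eqVlt => /predU1P[->//|]; apply: IH.
Qed.

(** The generators in s are treated one at a time: on the submodule X killed by
the previous ones, multiplication by the next generator a is open onto its image
by artin_rees. *)
Lemma approximate_killed (V : lmodType R) (s : seq R) N : closed_submodules V ->
  exists K, {subset colon [in s] (mpow m K) <=
             sumsm (mpow m N) (colon [in s] (pred1 (0 : V)))}.
Proof.
move=> closedV; have hX (t : seq R) := colon_submod [in t] (zero_submod V).
have hM n := mpow_submod m V n.
elim: s N => [|a s IH] N.
  by exists 0%N => y _; apply: sumsmr => //; apply/asboolP.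
pose X : {pred V} := colon [in s] (pred1 0); have hXs : submod_closed X := hX s.
have [|||K0 K0P] := @artin_rees V (multiples a (meet X (mpow m N))) (multiples a X) N closedV.
- by apply/multiples_submod/meet_submod.
- exact: multiples_submod.
- move=> r _ rI /asboolP[x xX ->]; apply/asboolP; exists (r *: x); last exact: scalerCA.
  by apply/andP; split; [apply: smodZ | apply: mpow_scale].
have [K' K'P] := IH (maxn K0 N); exists (maxn K' K0) => y /asboolP yK.
have /K'P/asboolP[v vX yv] : y \in colon [in s] (mpow m K').
  apply/asboolP => b bs; apply: (mpow_mono (leq_maxl K' K0)).
  by apply: yK; rewrite inE bs orbT.
have /asboolP[v' /andP[v'X v'N] av] : a *: v \in multiples a (meet X (mpow m N)).
  apply: K0P; first by apply/asboolP; exists v.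
  rewrite -[v](subKr y) scalerBr; apply: smodB => //.
    by apply: (mpow_mono (leq_maxr K' K0)); apply: yK; apply: mem_head.
  by apply: smodZ => //; apply: (mpow_mono (leq_maxl K0 N)).
apply/asboolP; exists (v - v').
  apply/asboolP => b; rewrite inE => /predU1P[->|bs].
    by rewrite scalerBr av subrr; apply: eqxx.
  by have /asboolP := smodB hXs vX v'X; apply.
rewrite opprB addrCA addrC; apply: smodD => //.
exact: (mpow_mono (leq_maxr K0 N)).
Qed.

(** Otherwise every element of U is killed by something outside p.  As t^K is
outside p, one finds w_n in U, deeper and deeper in the m-adic filtration, and
a_n outside p with a_n w_j = 0 for j < n and a_n w_n nonzero modulo a power of m
that contains all later w_j.  Multiplying a relation by a_n isolates its n-th
coefficient, so the sequence is residually free. *)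
Lemma koatt_annihilator_element (V : lmodType R) (p : {pred R}) t (U : {pred V}) :
  closed_submodules V -> prime_ideal p -> t \in m -> t \notin p -> submod_closed U ->
  {subset annihilator U <= p} ->
  exists2 u, u \in U & forall r, r *: u = 0 -> r \in p.
Proof.
move=> closedV [[p0 p1 pL] pP] tm tp hU Up; apply: contrapT => nu.
have pM a b : a \notin p -> b \notin p -> a * b \notin p.
  by move=> ap bp; apply/negP => /pP; rewrite (negPf ap) (negPf bp).
have tX n : t ^+ n \notin p by elim: n => [|n IH]; rewrite ?expr0// exprS pM.
have kill u : u \in U -> exists2 r, r \notin p & r *: u = 0.
  move=> uU; apply: contrapT => nr; apply: nu; exists u => // r ru.
  by apply: contrapT => /negP rp; apply: nr; exists r.
pose S := {s : R * nat | s.1 \notin p}.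
pose step (s s' : S) := exists w : V, [/\ w \in mpow m (sval s).2,
  (sval s).1 *: w \notin mpow m (sval s').2, (sval s').1 *: w = 0,
  exists r, (sval s').1 = r * (sval s).1 & ((sval s).2 < (sval s').2)%N].
have next s : {s' | step s s'}.
  apply: cid; case: s => -[a K] /= ap.
  have [u uU atu] : exists2 u, u \in U & (a * t ^+ K) *: u <> 0.
    apply: contrapT => nz; case/negP: (pM _ _ ap (tX K)); apply/Up/asboolP => u uU.
    by apply: contrapT => uz; apply: nz; exists u.
  have [r rp ru] := kill _ (smodZ (t ^+ K) hU uU).
  have [L aL] : exists L, a *: (t ^+ K *: u) \notin mpow m L.
    apply: contrapT => nL; apply: atu; rewrite -scalerA; apply: (separated closedV) => n.
    by apply: contrapT => /negP an; apply: nL; exists n.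
  exists (exist _ (r * a, maxn L K.+1) (pM _ _ rp ap)), (t ^+ K *: u); split=> /=.
  - by rewrite mpow_scale// idealX_exp.
  - by apply: contraNN aL; apply: mpow_mono; apply: leq_maxl.
  - by rewrite mulrC -scalerA ru scaler0.
  - by exists r.
  - exact: leq_maxr.
have [f [_ fS]] := dependent_choice next (exist _ (1, 0%N) p1 : S).
have [w wP] := choice fS.
pose a n := (sval (f n)).1; pose K n := (sval (f n)).2.
have Kmono n k : (n <= k)%N -> (K n <= K k)%N.
  move=> /subnK <-; elim: (k - n)%N => [//|d IH]; rewrite addSn.
  by have [_ _ _ _ /ltnW] := wP (d + n)%N; apply: leq_trans.
have Kn n : (n <= K n)%N.
  by elim: n => // n IH; have [_ _ _ _ lt] := wP n; apply: leq_ltn_trans lt.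
have aw n k : (n < k)%N -> a k *: w n = 0.
  elim: k => // k IH; rewrite ltnS leq_eqVlt => /predU1P[->|/IH nk].
    by have [_ _ ->] := wP k.
  by have [_ _ _ [r ra] _] := wP k; rewrite /a ra -scalerA nk scaler0.
apply: (not_residually_free (w := w) closedV (zero_submod V)) => [n|].
  by have [wm _ _ _ _] := wP n; apply: mpow_mono wm.
move=> n c /eqP sum0 i lin; have [_ awi _ _ _] := wP i.
have hM k := mpow_submod m V k.
apply: contraNT awi => cm; apply: (scale_notin_m (hM _) cm).
have : a i *: (\sum_(j < n) c j *: w j) \in mpow m (K i.+1).
  by rewrite sum0 scaler0; case: (hM (K i.+1)).
rewrite (bigD1 (Ordinal lin)) //= scalerDr scalerCA => s_in.
rewrite -[_ *: _](addrK (a i *: \sum_(j < n | j != Ordinal lin) c j *: w j)).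
apply: smodB => //; rewrite scaler_sumr; apply: smod_sum => // j ji.
rewrite scalerCA; apply: smodZ => //.
have [ij|ij] := ltnP i j.
  apply: smodZ => //; have [wm _ _ _ _] := wP j.
  by apply: mpow_mono wm; apply: Kmono.
rewrite aw; first by case: (hM (K i.+1)).
by rewrite ltn_neqAle ij andbT -[_ == _ :> nat]/(val j == val (Ordinal lin)) val_eqE.
Qed.

(** Krull's intersection theorem: if W is critical for r, then some power of m
carries 1 into W. *)
Lemma ideal_closed (c : {pred R^o}) r : submod_closed c ->
  (forall N, r \in sumsm (idealX m N) c) -> r \in c.
Proof.
move=> hc rN; apply: contrapT => /negP /(critical_exists hc)[W Wr cW].
have [hW rW _] := Wr; have [K KW] := critical_torsion Wr (1 : R^o).
have /asboolP[b /cW bW /KW] := rN K; rewrite [_ *: _]mulr1 => rb.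
by case/negP: rW; apply: (smod_transfer hW) bW.
Qed.

(** * Coordinates in a direct sum *)

Section DirectSum.
Variables (I : Type) (M : I -> lmodType R).
Local Notation D := (dsum M).
Implicit Types (x y u v : D) (i j : {classic I}) (J : seq {classic I}).

Definition coord i x : M i := dsum_val x i.

Arguments coord : simpl never.

Fact coord_linear i : linear (coord i).
Proof. by []. Qed.

HB.instance Definition _ i := GRing.isLinear.Build R D (M i) *:%R (coord i) (coord_linear i).

Lemma coord0 i : coord i 0 = 0. Proof. by []. Qed.
Lemma coordD i x y : coord i (x + y) = coord i x + coord i y. Proof. by []. Qed.
Lemma coordB i x y : coord i (x - y) = coord i x - coord i y. Proof. by []. Qed.
Lemma coordZ i r x : coord i (r *: x) = r *: coord i x. Proof. by []. Qed.

Lemma coord_sum i n (F : 'I_n -> D) :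
  coord i (\sum_(k < n) F k) = \sum_(k < n) coord i (F k).
Proof. exact: (linear_sum (coord i)). Qed.

Lemma dsum_ext x y : (forall i, coord i x = coord i y) -> x = y.
Proof. by move=> xy; apply: val_inj; apply: functional_extensionality_dep. Qed.

Definition inj_fun i (a : M i) : dprod M :=
  fun j => if pselect (i = j) is left e then eq_rect i M a j e else 0.

Fact inj_support i (a : M i) : inj_fun a \in @finite_support R I M.
Proof.
apply/asboolP; apply: (sub_finite_set (B := [set i]%classic)); last exact: finite_set1.
by move=> j /=; rewrite /inj_fun; case: pselect => // _; rewrite eqxx.
Qed.

Definition inj i (a : M i) : D := DSum (inj_support a).

Lemma coord_inj i (a : M i) : coord i (inj a) = a.
Proof.
rewrite /coord /= /inj_fun; case: pselect => // e.
by rewrite (Prop_irrelevance e erefl).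
Qed.

Lemma coord_inj_neq i j (a : M i) : i <> j -> coord j (inj a) = 0.
Proof. by move=> ij; rewrite /coord /= /inj_fun; case: pselect. Qed.

Lemma inj_linear i : linear (@inj i).
Proof.
move=> r a b; apply: dsum_ext => j; rewrite coordD coordZ.
have [<-|ij] := pselect (i = j); first by rewrite !coord_inj.
by rewrite !coord_inj_neq// scaler0 addr0.
Qed.

HB.instance Definition _ i := GRing.isLinear.Build R (M i) D *:%R (@inj i) (@inj_linear i).

Lemma dsum_support x : exists J, forall i, i \notin J -> coord i x = 0.
Proof.
have /asboolP fx := dsum_valP x.
have [J Jx] := proj1 (@finite_seqP {classic I} _) fx; exists J => i; apply: contraNeq => xi.
by change ([set` J]%classic i); rewrite -Jx; apply: xi.
Qed.

Lemma mpow_of_coord n x : (forall i, coord i x \in mpow m n) -> x \in mpow m n.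
Proof.
have [J] := dsum_support x; have hM := mpow_submod m D n.
elim: J x => [|i J IH] x xJ xn.
  suff -> : x = 0 by case: hM.
  by apply: dsum_ext => i; rewrite xJ// coord0.
rewrite -[x](subrK (inj (coord i x))); apply: smodD => //; last exact: mpow_linear.
apply: IH => j.
  move=> jJ; rewrite coordB; have [<-|ij] := pselect (i = j).
    by rewrite coord_inj subrr.
  rewrite coord_inj_neq// subr0 xJ// inE negb_or jJ andbT.
  by apply/eqP => /esym.
rewrite coordB; apply: smodB => //; first exact: mpow_submod.
have [<-|ij] := pselect (i = j); first by rewrite coord_inj.
by rewrite coord_inj_neq//; case: (mpow_submod m (M j) n).
Qed.

Definition vanish J : {pred D} := fun u => `[< forall j, j \in J -> coord j u = 0 >].

Lemma vanish_submod J : submod_closed (vanish J).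
Proof.
split=> [|a u v /asboolP uJ /asboolP vJ]; apply/asboolP => j jJ.
  by rewrite coord0.
by rewrite coordD coordZ uJ// vJ// scaler0 addr0.
Qed.

Definition disjoint_supports (u : nat -> D) :=
  forall k l i, k != l -> coord i (u k) = 0 \/ coord i (u l) = 0.

(** The state of the construction records the coordinates used so far. *)
Lemma disjoint_sequence (Q : nat -> {pred D}) :
  (forall J n, exists2 u, u \in Q n & u \in vanish J) ->
  exists2 u, forall n, u n \in Q n & disjoint_supports u.
Proof.
move=> QJ; pose S := (seq {classic I} * nat)%type.
pose step (s s' : S) := exists u, [/\ u \in Q s.2, u \in vanish s.1,
  {subset s.1 <= s'.1}, forall i, i \notin s'.1 -> coord i u = 0 & s'.2 = s.2.+1].
have next s : {s' | step s s'}.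
  apply: cid; case: s => J n; have [u uQ uJ] := QJ J n; have [J' uJ'] := dsum_support u.
  exists (J ++ J', n.+1), u; split=> //= [i iJ|i]; rewrite mem_cat ?iJ// negb_or.
  by case/andP => _ /uJ'.
have [f [f0 fS]] := dependent_choice next ([::], 0%N).
have [u uP] := choice fS.
have f2 n : (f n).2 = n.
  by elim: n => [|n IH]; [rewrite f0 | have [_ _ _ _ ->] := uP n; rewrite IH].
exists u => [n|k l i]; first by have [] := uP n; rewrite f2.
have lt a b : (a < b)%N -> coord i (u a) = 0 \/ coord i (u b) = 0.
  move=> ab; have [ib|ib] := boolP (i \in (f b).1).
    by right; have [_ /asboolP ub _ _ _] := uP b; apply: ub.
  left; have [_ _ _ ua _] := uP a; apply: ua; apply: contraNN ib.
  elim: b ab => // b IH; rewrite ltnS leq_eqVlt => /predU1P[->//|/IH + ia].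
  by have [_ _ sub _ _] := uP b => /(_ ia) /sub.
by rewrite neq_ltn => /orP[/lt//|/lt[]]; auto.
Qed.

(** A coordinate where u i is nonzero isolates the coefficient of u i. *)
Lemma disjoint_residually_free (u : nat -> D) : disjoint_supports u ->
  (forall n, u n <> 0) -> residually_free (pred1 0) u.
Proof.
move=> du u0 n c /eqP sum0 i lin.
have [j uj] : exists j, coord j (u i) <> 0.
  apply: contrapT => nj; apply: (u0 i); apply: dsum_ext => j; rewrite coord0.
  by apply: contrapT => uj; apply: nj; exists j.
have uj0 (l : 'I_n) : l != Ordinal lin -> coord j (c l *: u l) = 0.
  move=> li; rewrite coordZ; have [|uil|->] := du i l j; last exact: scaler0.
    by apply: contra_neq li => il; apply/val_inj.
  by case: uj.
have := congr1 (coord j) sum0; rewrite coord0 coord_sum (bigD1 (Ordinal lin))//= big1//.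
rewrite addr0 coordZ => cu; apply: contrapT => /negP cm; apply: uj; apply/eqP.
by apply: (scale_notin_m (zero_submod (M j)) cm); apply/eqP.
Qed.

(** * Recurrent ideals *)

Section Recurrent.
Variable p : {pred R}.

Definition recurrent (c : {pred R^o}) := submod_closed c /\
  forall J n, exists u, [/\ u \in colon p (pred1 0), u \in mpow m n, u \in vanish J &
    forall r : R, r *: u = 0 -> r \in c].

Lemma recurrent_top : recurrent predT.
Proof.
split=> // J n; exists 0; split=> //; first by case: (colon_submod p (zero_submod D)).
  by case: (mpow_submod m D n).
by case: (vanish_submod J).
Qed.

(** The annihilator of a sum of two elements with disjoint supports is the
intersection of their annihilators. *)
Lemma recurrent_meet c d : recurrent c -> recurrent d -> recurrent (meet c d).
Proof.
move=> [hc cP] [hd dP]; split=> [|J n]; first exact: meet_submod.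
have [u [up un uJ uc]] := cP J n; have [J' uJ'] := dsum_support u.
have [v [vp vn vJ vd]] := dP (J ++ J') n.
exists (u + v); split=> [||| r ruv].
- by apply: smodD => //; apply: colon_submod; apply: zero_submod.
- by apply: smodD => //; apply: mpow_submod.
- apply: smodD => //; first exact: vanish_submod.
  by apply/asboolP => j jJ; have /asboolP := vJ; apply; rewrite mem_cat jJ.
have ru : r *: u = 0.
  apply: dsum_ext => i; rewrite coordZ coord0.
  have [iJ|iJ] := boolP (i \in J'); last by rewrite uJ'// scaler0.
  have := congr1 (coord i) ruv; rewrite coordZ coordD coord0.
  by have /asboolP -> := vJ; rewrite ?addr0// mem_cat iJ orbT.
apply/andP; split; first exact: uc.
by apply: vd; move: ruv; rewrite scalerDr ru add0r.
Qed.

(** With W critical for a u_0 and containing every a u_n - a u_0, no a u_n is in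
W.  The chain of submodules spanned by W and the u_l with l >= k stabilizes at
some k0, so u_k0 is congruent modulo W to a combination b of arbitrarily late
terms.  What kills b carries u_k0 into W. *)
Lemma recurrent_avoid (U : {pred D}) a : submod_closed U ->
  {subset U <= colon p (pred1 0)} ->
  (forall J n, exists u, [/\ u \in U, u \in mpow m n, u \in vanish J & a *: u <> 0]) ->
  exists2 c, recurrent c & a \notin c.
Proof.
move=> hU Up UJ.
pose Q n : {pred D} := fun u => `[< [/\ u \in U, u \in mpow m n & a *: u <> 0] >].
have [J n|u uQ du] := disjoint_sequence (Q := Q).
  by have [u [uU un uJ au]] := UJ J n; exists u => //; apply/asboolP.
have {uQ} uP n : [/\ u n \in U, u n \in mpow m n & a *: u n <> 0] by apply/asboolP/uQ.
have dau : disjoint_supports (fun n => a *: u n).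
  move=> k l i kl; rewrite !coordZ.
  by have [->|->] := du k l i kl; rewrite scaler0; auto.
have freeu : residually_free (pred1 0) (fun n => a *: u n).
  by apply: disjoint_residually_free => // n; have [] := uP n.
have hS := comb_submod (fun n => a *: u n.+1 - a *: u 0%N).
have z0 := residually_free_diff (zero_submod D) freeu.
have [|W Wz SW] := critical_exists _ z0; first exact: sumsm_submod (zero_submod D) _.
have [hW zW _] := Wz.
have auW n : a *: u n \notin W.
  case: n => // n; apply: contraNN zW => aun.
  rewrite -[X in X \in _](subKr (a *: u n.+1)); apply: smodB => //; apply: SW.
  apply: sumsmr (zero_submod D) _.
  exact: (comb_gen (fun n => a *: u n.+1 - a *: u 0%N)).
pose F k := sumsm W (comb (fun l => u (k + l)%N)).
have hC k := comb_submod (fun l => u (k + l)%N).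
have [||//||k0 stab] := critical_dcc Wz (F := F).
- by move=> k; apply: sumsm_submod.
- by move=> k x; apply: sumsml.
- move=> k; apply: sumsmS; apply: comb_sub => // l.
  by rewrite addSnnS; apply: (comb_gen (fun l => u (k + l)%N)).
exists (fun r : R => r *: u k0 \in W); last exact: auW.
split=> [|J n].
  split=> [|r x y xW yW]; first by rewrite unfold_in scale0r; case: hW.
  by rewrite unfold_in scalerDl -scalerA; apply: smodD => //; apply: smodZ.
(* A coordinate lies in the support of at most one term. *)
have [k kP] : exists k, forall l, (k <= l)%N -> u l \in vanish J.
  elim: J => [|i J [k kP]]; first by exists 0%N => l _; apply/asboolP.
  have [k' k'P] : exists k', forall l, (k' <= l)%N -> coord i (u l) = 0.
    have [[l0 ul0]|none] := pselect (exists l0, coord i (u l0) <> 0).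
      exists l0.+1 => l ll; have [|//|//] := du l0 l i; by rewrite ltn_eqF.
    by exists 0%N => l _; apply: contrapT => ul; apply: none; exists l.
  exists (maxn k k') => l; rewrite geq_max => /andP[/kP/asboolP ukJ /k'P uki].
  by apply/asboolP => j; rewrite inE => /predU1P[->|/ukJ].
pose K := maxn k0 (maxn k n).
have u0F : u k0 \in F k0.
  by apply: sumsmr => //; rewrite -[X in u X]addn0; apply: (comb_gen (fun l => u (k0 + l)%N)).
have /asboolP[b bC ub] := stab K (leq_maxl _ _) _ u0F.
have bN (N : {pred D}) : submod_closed N -> (forall l, (K <= l)%N -> u l \in N) -> b \in N.
  by move=> hN uN; apply: (comb_sub hN) bC => l; apply/uN/leq_addr.
exists b; split.
- by apply/Up/bN => // l _; have [] := uP l.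
- apply: bN => [|l Kl]; first exact: mpow_submod.
  have [_ ul _] := uP l; apply: mpow_mono ul.
  by apply: leq_trans Kl; rewrite !leq_max leqnn !orbT.
- apply: bN => [|l Kl]; first exact: vanish_submod.
  by apply: kP; apply: leq_trans Kl; rewrite !leq_max leqnn !orbT.
move=> r rb; rewrite unfold_in -[u k0](subrK b) scalerDr rb addr0.
exact: smodZ.
Qed.

(** K + R x over K is simple or zero.  Either some recurrent d in c meets K + R x
inside K, and then d is as required; or every recurrent ideal in c contains an
element that is congruent to a unit multiple of x modulo K, and then c itself
is. *)
Lemma recurrent_refine (K : {pred R^o}) (x : R) : submod_closed K ->
  (forall a, a \in m -> a * x \in K) ->
  (exists2 c, recurrent c & forall d, recurrent d -> {subset c <= sumsm (sumsm K (line (x : R^o))) d}) ->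
  exists2 c, recurrent c & forall d, recurrent d -> {subset c <= sumsm K d}.
Proof.
move=> hK mx [c rc cP]; pose Kx := sumsm K (line (x : R^o)).
have hL := line_submod (x : R^o); have hKx : submod_closed Kx by apply: sumsm_submod.
have [[d [rd dc dK]]|none] := pselect (exists d, [/\ recurrent d, {subset d <= c} &
    forall r, r \in d -> r \in Kx -> r \in K]).
  exists d => // e re y yd; have rde := recurrent_meet rd re.
  have /asboolP[b /andP[bd be] yb] := cP _ rde _ (dc _ yd).
  apply/asboolP; exists b => //; apply: dK => //.
  by apply: smodB => //; case: rd.
exists c => // e re y yc; have rce := recurrent_meet rc re.
have [hce _] := rce; have [he _] := re.
have /asboolP[b bce yb] := cP _ rce _ yc.
have xce : (x : R^o) \in sumsm K (meet c e).
  apply: contrapT => /negP xn; apply: none; exists (meet c e).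
  split=> // [v /andP[]//|v vce /asboolP[_ /asboolP[r ->] vr]].
  have rm : r \in m.
    apply: contraNT xn => rm; have hS := sumsm_submod hK hce.
    apply: (scale_notin_m hS rm); rewrite -[_ *: _](subKr v); apply: smodB => //.
      exact: sumsmr.
    exact: sumsml.
  exact: (smod_transfer hK vr) (mx _ rm).
have : y \in sumsm K (meet c e).
  have hS := sumsm_submod hK hce; apply: (smod_transfer hS) (sumsmr hK bce).
  have /asboolP[_ /asboolP[r ->] ybr] := yb.
  apply: (smod_transfer hS (sumsml hce ybr)); exact: smodZ.
by apply: sumsmS => v /andP[].
Qed.

(** R / m^N has finite length: m^N is reached from R through finitely many steps
to which recurrent_refine applies. *)
Lemma recurrent_minimal N : exists2 c, recurrent c &
  forall d, recurrent d -> {subset c <= sumsm (idealX m N) d}.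
Proof.
elim: N => [|N [c rc cP]].
  by exists (predT : {pred R^o}); [apply: recurrent_top | move=> d [hd _] r _; apply: sumsml].
have hI n := idealX_submod m n.
have [s [sI sgen]] := ideal_generators (hI N).
(* K t is spanned by m^(N+1) and t; the generators s of m^N are dropped one by
   one. *)
pose K := foldr (fun (x : R) (K : {pred R^o}) => sumsm K (line (x : R^o))) (idealX m N.+1).
have hK t : submod_closed (K t).
  elim: t => [|x t IH]; first exact: hI.
  by apply: sumsm_submod IH _; apply: line_submod.
have IK t : {subset idealX m N.+1 <= K t}.
  by elim: t => [//|x t IH] y yI; apply: sumsml; [apply: line_submod | apply: IH].
have sK : {subset s <= K s}.
  elim: s {sI sgen} => // x t IH y; rewrite inE => /predU1P[->|/IH yt].
    by apply: (sumsmr (hK t)); apply: line_gen.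
  by apply: sumsml => //; apply: line_submod.
have NK : {subset idealX m N <= K s}.
  move=> x xN; have := sgen _ (K s) (1 : R^o) (hK s) _ x xN.
  by rewrite [_ *: _]mulr1; apply=> y /sK; rewrite [_ *: _]mulr1.
have : exists2 c, recurrent c & forall d, recurrent d -> {subset c <= sumsm (K s) d}.
  exists c => // d rd y yc; have /asboolP[b bd /NK yb] := cP _ rd _ yc.
  by apply/asboolP; exists b.
elim: s sI {sgen sK NK} => // x t IH sI Kx.
apply: IH => [y yt|]; first by apply: sI; rewrite inE yt orbT.
apply: recurrent_refine Kx => // a am; apply: IK; apply: idealXS_mul => //.
exact: sI (mem_head _ _).
Qed.

End Recurrent.

(** One coordinate i at a time.  If s outside p killed the elements of the
previous tail that vanish at i, the i-th coordinates of the multiples s u would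
have annihilator p: when r kills them, r s u vanishes at i and r s s kills u.
By koatt_annihilator_element one such s u then has annihilator p. *)
Lemma tail_annihilator (p : {pred R}) t (U : {pred D}) :
  (forall i, closed_submodules (M i)) -> prime_ideal p -> t \in m -> t \notin p ->
  submod_closed U -> {subset annihilator U <= p} ->
  (forall u, u \in U -> exists2 r, r *: u = 0 & r \notin p) ->
  forall J, {subset annihilator (meet U (vanish J)) <= p}.
Proof.
move=> closedM hp tm tp hU Up nU; have [[p0 p1 pL] pP] := hp.
have hUJ J := meet_submod hU (vanish_submod J).
elim=> [|i J IH] s /asboolP sUJ.
  by apply: Up; apply/asboolP => u uU; apply: sUJ; apply/andP; split=> //; apply/asboolP.
apply: contrapT => /negP sp.
pose W : {pred M i} := fun b => `[< exists2 u, u \in meet U (vanish J) & b = s *: coord i u >].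
have hW : submod_closed W.
  split=> [|a _ _ /asboolP[u uJ ->] /asboolP[v vJ ->]]; apply/asboolP.
    by exists 0; [case: (hUJ J) | rewrite coord0 scaler0].
  exists (a *: u + v); first by apply: smodD => //; apply: smodZ.
  by rewrite coordD coordZ scalerDr scalerCA.
have [|_ /asboolP[u uJ ->] uP] := koatt_annihilator_element (closedM i) hp tm tp hW.
  move=> r /asboolP rW; have : r * s * s \in p.
    apply: IH; apply/asboolP => u uUJ; rewrite mulrC -scalerA.
    have /andP[uU uJ] := uUJ.
    apply: sUJ; apply/andP; split; first by apply: smodZ.
    apply/asboolP => j; rewrite inE => /predU1P[->|jJ].
      by rewrite coordZ -scalerA; apply: rW; apply/asboolP; exists u.
    by have /asboolP := smodZ (r * s) (vanish_submod J) uJ; apply.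
  by move=> /pP; rewrite (negPf sp) orbF => /pP; rewrite (negPf sp) orbF.
have /andP[uU _] := uJ; have [r ru /negP] := nU _ (smodZ s hU uU); apply.
by apply: uP; rewrite -coordZ -coordZ ru.
Qed.

End DirectSum.
End LocalRing.

(** * Elements of the completion *)

Section CompletionElements.
Variables (R : comNzRingType) (m : {pred R}) (V : lmodType R).
Local Open Scope quotient_scope.

Lemma completion_scale_eq0 (x : completion m V) (y : nat -> V) (r : R) :
  (forall n, \pi_(quotmod (mpow m n)) (y n) = completion_val x n) ->
  r *: x = 0 <-> forall n, r *: y n \in mpow m n.
Proof.
move=> yx.
have E n : (r *: y n \in mpow m n) = (r *: completion_val x n == 0).
  have -> : r *: completion_val x n = \pi_(quotmod (mpow m n)) (r *: y n).
    by rewrite -yx; apply: (pi_quotmod_scale (mpow m n)).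
  have <- : \pi_(quotmod (mpow m n)) 0 = 0 :> quot_mpow m V n by rewrite piE.
  by rewrite -[LHS](congr1 (fun v => v \in mpow m n) (subr0 _)) -pi_quotmod_eq.
split=> [rx n|ry].
  rewrite E; apply/eqP; have := congr1 (fun z => completion_val z n) rx; exact.
by apply: val_inj; apply: functional_extensionality_dep => n; apply/eqP; rewrite -E.
Qed.

Lemma completion_lift (y : nat -> V) :
  (forall n, y n.+1 - y n \in mpow m n) ->
  exists x : completion m V, forall n, \pi_(quotmod (mpow m n)) (y n) = completion_val x n.
Proof.
move=> yS; pose f : dprod (quot_mpow m V) := fun n => \pi_(quotmod (mpow m n)) (y n).
have fP : f \in @compatible R m V.
  by apply/asboolP => n; rewrite /f transitionE; apply/eqP; rewrite pi_quotmod_eq.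
by exists (Completion fP).
Qed.

Lemma completion_repr (x : completion m V) : exists y : nat -> V,
  (forall n, \pi_(quotmod (mpow m n)) (y n) = completion_val x n) /\
  forall n k, (n <= k)%N -> y k - y n \in mpow m n.
Proof.
pose y n : V := repr (completion_val x n : quotmod (mpow m n)).
have yx n : \pi_(quotmod (mpow m n)) (y n) = completion_val x n by apply: reprK.
have yS n : y n.+1 - y n \in mpow m n.
  have /asboolP xS := completionP x.
  by rewrite -pi_quotmod_eq -transitionE yx xS -yx.
exists y; split=> // n k /subnK <-; elim: (k - n)%N => [|d IH].
  by rewrite subrr; case: (mpow_submod m V n).
rewrite addSn -[y _](subrK (y (d + n)%N)) -addrA.
apply: smodD (mpow_submod m V n) _ IH.
by apply: mpow_mono (yS _); apply: leq_addl.
Qed.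

End CompletionElements.

(** * The two inclusions *)

Section MainInclusions.
Variables (R : comNzRingType) (m : {pred R}).
Hypotheses (noethR : noetherian_ring R) (localR : local_ring m).
Variables (I : Type) (M : I -> lmodType R).
Hypothesis closedM : forall i, closed_submodules m (M i).
Local Notation D := (dsum M).

(** Since supports are disjoint, a coordinate of a partial sum is a coordinate of
a single term, and the M i are separated. *)
Lemma disjoint_series (u : nat -> D) :
  (forall n, u n \in mpow m n) -> disjoint_supports u ->
  exists x : completion m D, forall r, r *: x = 0 <-> forall n, r *: u n = 0.
Proof.
move=> um du; pose y n := \sum_(k < n) u k.
have [|x yx] := @completion_lift R m D y.
  by move=> n; rewrite /y big_ord_recr /= addrAC subrr add0r.
exists x => r; rewrite (completion_scale_eq0 r yx); split=> [ry n|ru n]; last first.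
  rewrite scaler_sumr big1 => [|k _]; last exact: ru.
  by case: (mpow_submod m D n).
apply: dsum_ext => i; rewrite coord0.
have [ui|/eqP ui] := eqVneq (coord i (u n)) 0; first by rewrite coordZ ui scaler0.
apply: (separated (@closedM i)) => N.
have : coord i (r *: y (n.+1 + N)%N) \in mpow m (n.+1 + N) := mpow_linear (coord i) (ry _).
rewrite coordZ coord_sum.
have lin : (n < n.+1 + N)%N by rewrite addSn ltnS leq_addr.
have uk0 (k : 'I_(n.+1 + N)) : k != Ordinal lin -> coord i (u k) = 0.
  move=> kn; have [|//|//] := du k n i.
  by apply: contra_neq kn => kn; apply/val_inj.
rewrite (bigD1 (Ordinal lin))//= big1// addr0 -coordZ.
by apply: mpow_mono; apply: leq_addl.
Qed.

(** The submodule of elements killed by p has annihilator p. *)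
Lemma Ass_completion_sub p : Ass (completion m D) p -> Koatt D p.
Proof.
move=> [hp [x px]]; split=> //; exists (colon p (pred1 0)).
split; first exact/colon_submod/zero_submod.
move=> r; apply/idP/asboolP => [rp u /asboolP uP|rU]; first exact/eqP/uP.
rewrite px; apply/eqP; have [y [yx yS]] := completion_repr x.
apply/(completion_scale_eq0 r yx) => N; apply: mpow_of_coord => i.
have ideal_p : submod_closed (p : {pred R^o}).
  by have [[p0 _ pL] _] := hp; split=> // a u v; apply: pL.
have [s [sp sgen]] := ideal_generators noethR ideal_p.
have [K KP] := approximate_killed localR s N (@closedM i).
have /KP/asboolP[v /asboolP vs yv] : coord i (y (maxn K N)) \in colon [in s] (mpow m K).
  apply/asboolP => a as_; rewrite -coordZ; apply: mpow_linear.
  have : a *: x = 0 by apply/eqP; have := sp _ as_; rewrite px.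
  by move/(completion_scale_eq0 a yx)/(_ (maxn K N)); apply: mpow_mono; apply: leq_maxl.
have rv : r *: v = 0.
  rewrite -[v](coord_inj v) -coordZ rU ?coord0//.
  apply/asboolP => a ap; apply/eqP; apply: dsum_ext => j; rewrite coordZ coord0.
  have [<-|ij] := pselect (i = j); last by rewrite coord_inj_neq ?scaler0.
  by rewrite coord_inj; apply/eqP; apply: (sgen _ _ v (zero_submod (M i)) vs).
have hM := mpow_submod m (M i) N.
have yN : coord i (y N) - coord i (y (maxn K N)) \in mpow m N.
  by rewrite -coordB; apply: mpow_linear; apply: smodBC (mpow_submod m D N) _; apply/yS/leq_maxr.
rewrite coordZ -[coord i (y N)](subrK (coord i (y (maxn K N)))) scalerDr.
apply: smodD => //; first exact: smodZ.
by rewrite -[coord i _](subrK v) scalerDr rv addr0; apply: smodZ.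
Qed.

(** An element u of U with annihilator p is its own series.  Otherwise p differs
from m, since p = m would be the annihilator of every nonzero element of U, and
the series is built from the recurrent ideals. *)
Lemma Koatt_sub_Ass_completion p : Koatt D p -> Ass (completion m D) p.
Proof.
move=> [hp [U [hU pU]]]; split=> //; have [[p0 p1 pL] pP] := hp.
have Up : {subset U <= colon p (pred1 0)}.
  by move=> u uU; apply/asboolP => a; rewrite pU => /asboolP aU; apply/eqP/aU.
have annU : {subset annihilator U <= p} by move=> r; rewrite pU.
have [[u uU up]|none] := pselect (exists2 u, u \in U & forall r, r *: u = 0 -> r \in p).
  pose w n : D := if n is 0%N then u else 0.
  have [||x xP] := @disjoint_series w.
  - by case=> [|n]; [apply: mpow0 | case: (mpow_submod m D n.+1)].
  - by move=> [|k] [|l] i //= _; auto.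
  exists x => r; apply/idP/eqP => [rp|/xP/(_ 0%N)]; last exact: up.
  apply/xP => -[|n] /=; last exact: scaler0.
  by have /asboolP := Up _ uU => /(_ _ rp) /eqP.
have nU u : u \in U -> exists2 r, r *: u = 0 & r \notin p.
  move=> uU; apply: contrapT => nr; apply: none; exists u => // r ru.
  by apply: contrapT => /negP rp; apply: nr; exists r.
have [t tm tp] : exists2 t, t \in m & t \notin p.
  apply: contrapT => nt; case/negP: p1; apply/annU/asboolP => u uU; rewrite scale1r.
  have [r ru rp] := nU _ uU; apply/eqP.
  apply: (scale_notin_m localR (zero_submod D) (r := r)); last exact/eqP.
  by apply: contraNN rp => rm; apply: contrapT => /negP rp; apply: nt; exists r.
have tX n : t ^+ n \notin p.
  elim: n => [|n IH]; rewrite ?expr0// exprS; apply/negP => /pP.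
  by rewrite (negPf tp) (negPf IH).
have tails := tail_annihilator localR closedM hp tm tp hU annU nU.
have recP a : a \notin p -> exists2 c, recurrent m M p c & a \notin c.
  move=> ap; apply: (recurrent_avoid noethR localR hU Up) => J n.
  have : a * t ^+ n \notin p by apply/negP => /pP; rewrite (negPf ap) (negPf (tX n)).
  move=> atn; have [u /andP[uU uJ] atu] : exists2 u, u \in meet U (vanish J) &
      (a * t ^+ n) *: u <> 0.
    apply: contrapT => nu; case/negP: atn; apply: (tails J); apply/asboolP => u uJ.
    by apply: contrapT => au; apply: nu; exists u.
  exists (t ^+ n *: u); split; last by rewrite scalerA.
  - exact: smodZ.
  - by apply: mpow_scale; apply: idealX_exp.
  - by apply: smodZ uJ; apply: vanish_submod.
have [c cP] := choice (fun N => proj1 (exists2P _ _) (recurrent_minimal noethR localR M p N)).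
pose Q n : {pred D} := fun u => `[< [/\ u \in colon p (pred1 0), u \in mpow m n &
  forall r, r *: u = 0 -> r \in c n] >].
have [J n|u uQ du] := disjoint_sequence (Q := Q).
  have [[_ cn] _] := cP n; have [u [up un uJ uc]] := cn J n.
  by exists u => //; apply/asboolP.
have {uQ} uP n := asboolP _ (uQ n).
have [|x xP] := disjoint_series _ du; first by move=> n; have [] := uP n.
exists x => r; apply/idP/eqP => [rp|/xP ru].
  by apply/xP => n; have [/asboolP/(_ _ rp)/eqP] := uP n.
apply: contrapT => /negP /recP[d rd]; have [hd _] := rd; move/negP; apply.
apply: (ideal_closed noethR localR hd) => N; have [_ cN] := cP N.
by apply: cN => //; have [_ _] := uP N; apply.
Qed.

End MainInclusions.

Theorem mainTheorem3 (R : comNzRingType) (m : {pred R})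
    (noethR : noetherian_ring R) (localR : local_ring m)
    (I : Type) (M : I -> lmodType R)
    (coatM : forall i : I, coatomic (M i)) :
  Ass (completion m (dsum M)) = Koatt (dsum M).
Proof.
have closedM i := coatomic_closed noethR localR (coatM i).
apply/seteqP; split=> p.
  exact: Ass_completion_sub.
exact: Koatt_sub_Ass_completion.
Qed.
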